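(* Let $W\in\mathbb{R}^{n\times n}$ be symmetric positive definite, let $T\in\mathbb{R}^{n\times n}$ be symmetric indefinite, let $A=W+\mathrm{i}T$, and let $\alpha>0$ be such that $\alpha T+W$ is positive definite. Let $$\mathcal{P}_{PLT}=\mathrm{i}\left(T+\frac{1}{\alpha}W\right),\qquad Z^{(\alpha)}=(\alpha T+W)^{-1/2}(T-\alpha W)(\alpha T+W)^{-1/2}.$$ Let $\tau_1,\dots,\tau_n$ be the eigenvalues of the real symmetric matrix $Z^{(\alpha)}$ and let $p_1,\dots,p_n\in\mathbb{R}^n$ be corresponding orthonormal eigenvectors. Then the eigenvalues of $\mathcal{P}_{PLT}^{-1}A$ are $$\eta_{T,j}=\frac{\alpha}{\alpha+\mathrm{i}}\,(1+\mathrm{i}\tau_j),\qquad j=1,\dots,n,$$ with corresponding eigenvectors $x_{T,j}=(\alpha T+W)^{-1/2}p_j$, $j=1,\dots,n$. Therefore $\mathcal{P}_{PLT}^{-1}A=X_T\Lambda_TX_T^{-1}$, where $X_T=(x_{T,1},\dots,x_{T,n})\in\mathbb{R}^{n\times n}$ and $\Lambda_T=\mathrm{diag}(\eta_{T,1},\dots,\eta_{T,n})\in\mathbb{C}^{n\times n}$, and $\kappa_2(X_T)=\sqrt{\kappa_2(\alpha T+W)}$.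
   Context: A real symmetric matrix is indefinite if it has at least one positive and at least one negative eigenvalue. For a symmetric positive definite matrix $S$, $S^{1/2}$ is its symmetric positive definite square root and $S^{-1/2}$ the inverse of $S^{1/2}$; $\kappa_2(X)=\|X\|_2\|X^{-1}\|_2$ is the spectral condition number. *)

(* Defs.v *)
From mathcomp Require Import all_boot all_order all_algebra.
From mathcomp Require Import sesquilinear.
From mathcomp Require Import all_classical all_reals.
From mathcomp Require Import complex.

Set Implicit Arguments.
Unset Strict Implicit.
Unset Printing Implicit Defensive.

Import Order.TTheory GRing.Theory Num.Theory.

Local Open Scope ring_scope.
Local Open Scope classical_set_scope.

Definition posdefmx (R : realType) (n : nat) (S : 'M[R]_n) : Prop :=
  forall v : 'cV[R]_n, v != 0 -> 0 < (v^T *m S *m v) 0 0.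

Definition indefinitemx (R : realType) (n : nat) (S : 'M[R]_n) : Prop :=
  (exists2 a : R, eigenvalue S a & 0 < a) /\
  (exists2 b : R, eigenvalue S b & b < 0).

(* The square root of a symmetric positive definite S exists and is unique, so
   the default value 0 and the choice made by xget are irrelevant for such S. *)
Definition sqrtmx (R : realType) (n : nat) (S : 'M[R]_n) : 'M[R]_n :=
  xget 0 [set Q : 'M[R]_n | [/\ Q \is symmetricmx, posdefmx Q & Q *m Q = S]].

Definition norm2 (R : realType) (n : nat) (v : 'cV[R]_n) : R :=
  Num.sqrt (\sum_i v i 0 ^+ 2).

Definition opnorm2 (R : realType) (n : nat) (A : 'M[R]_n) : R :=
  sup [set norm2 (A *m v) | v in [set v : 'cV[R]_n | norm2 v = 1]].

(* Only meaningful for A \in unitmx, since invmx A = A otherwise. *)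
Definition cond2 (R : realType) (n : nat) (A : 'M[R]_n) : R :=
  opnorm2 A * opnorm2 (invmx A).

(* The l j are the eigenvalues of A counted with algebraic multiplicity. *)
Definition eigenvalues_are (F : fieldType) (n : nat) (A : 'M[F]_n)
    (l : 'I_n -> F) : Prop :=
  char_poly A = \prod_(j < n) ('X - (l j)%:P).

(* Column eigenvectors; the library's eigenspace acts on row vectors. *)
Definition eigenvector (F : fieldType) (n : nat) (A : 'M[F]_n) (a : F)
    (v : 'cV[F]_n) : Prop :=
  v != 0 /\ A *m v = a *: v.

Definition orthonormal_family (R : realType) (n : nat)
    (p : 'I_n -> 'cV[R]_n) : Prop :=
  forall j k : 'I_n, ((p j)^T *m p k) 0 0 = (j == k)%:R.

Definition complexify (R : realType) (m n : nat) (A : 'M[R]_(m, n)) :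
    'M[R[i]]_(m, n) :=
  map_mx (real_complex R) A.

(* Main.v *)
(* Put Q = (alpha T + W)^(1/2) and P = (p_1, ..., p_n), so that X = Q^-1 P.
   From Z p_j = tau_j p_j one gets the real generalized eigenproblem
   (T - alpha W) x_j = tau_j (alpha T + W) x_j, which turns into
   A x_j = eta_j PLT x_j because
   (alpha + i) A = i ((alpha T + W) + i (T - alpha W)).
   Since P is orthogonal, X and X^-1 = P^T Q have the spectral norms of Q^-1
   and Q, and the norm of the square of a symmetric matrix is the square of
   its norm.  The square root Q exists because, by the complex spectral
   theorem, interpolating the fourth root on the (positive) spectrum of
   S = alpha T + W gives a real polynomial in S whose fourth power is S. *)

Require Import Defs.
From mathcomp Require Import all_boot all_order all_algebra.
From mathcomp Require Import sesquilinear.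
From mathcomp Require Import all_classical all_reals.
From mathcomp Require Import complex.
From mathcomp Require Import spectral ring lra.

Set Implicit Arguments.
Unset Strict Implicit.
Unset Printing Implicit Defensive.

Import Order.TTheory GRing.Theory Num.Theory.

Local Open Scope ring_scope.

Lemma symmetricmxE (R : realType) (n : nat) (M : 'M[R]_n) :
  (M \is symmetricmx) = (M^T == M).
Proof. by rewrite sesquiE expr0 scale1r map_mx_id // eq_sym. Qed.

Lemma complexify_hermsymmx (R : realType) (n : nat) (M : 'M[R]_n) :
  M^T = M -> complexify M \is hermsymmx.
Proof.
move=> MT; rewrite sesquiE expr0 scale1r; apply/eqP/matrixP => i j.
by rewrite !mxE -[in LHS]MT mxE; exact/esym/conjc_real.
Qed.

(** * Euclidean norm and the Cauchy-Schwarz inequality *)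

Lemma sqr_norm2_sum (R : realType) (n : nat) (v : 'cV[R]_n) :
  norm2 v ^+ 2 = \sum_i v i 0 ^+ 2.
Proof. by rewrite sqr_sqrtr //; apply: sumr_ge0 => i _; exact: sqr_ge0. Qed.

Lemma sqr_norm2 (R : realType) (n : nat) (v : 'cV[R]_n) :
  norm2 v ^+ 2 = (v^T *m v) 0 0.
Proof.
by rewrite sqr_norm2_sum mxE; apply: eq_bigr => i _; rewrite mxE expr2.
Qed.

Lemma norm2_ge0 (R : realType) (n : nat) (v : 'cV[R]_n) : 0 <= norm2 v.
Proof. exact: sqrtr_ge0. Qed.

Lemma norm2_eq0 (R : realType) (n : nat) (v : 'cV[R]_n) :
  (norm2 v == 0) = (v == 0).
Proof.
rewrite -sqrf_eq0 sqr_norm2_sum psumr_eq0; last by move=> i _; exact: sqr_ge0.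
apply/allP/eqP => [v0|-> i _]; last by rewrite mxE expr0n eqxx implybT.
apply/matrixP => i j; rewrite ord1 mxE; apply/eqP.
by rewrite -sqrf_eq0; exact: (implyP (v0 i (mem_index_enum i))).
Qed.

Lemma norm2Z (R : realType) (n : nat) (a : R) (v : 'cV[R]_n) :
  norm2 (a *: v) = `|a| * norm2 v.
Proof.
rewrite /norm2 -sqrtr_sqr -sqrtrM ?sqr_ge0 // mulr_sumr.
by congr Num.sqrt; apply: eq_bigr => i _; rewrite mxE exprMn.
Qed.

Lemma norm2_isometry (R : realType) (n : nat) (P : 'M[R]_n) (v : 'cV[R]_n) :
  P^T *m P = 1%:M -> norm2 (P *m v) = norm2 v.
Proof.
move=> PTP; apply/eqP; rewrite -(eqrXn2 (n := 2)) ?norm2_ge0 // !sqr_norm2.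
by rewrite trmx_mul mulmxA -(mulmxA v^T) PTP mulmx1.
Qed.

Lemma dot_le_norm2 (R : realType) (n : nat) (u v : 'cV[R]_n) :
  (u^T *m v) 0 0 <= norm2 u * norm2 v.
Proof.
have [->|u0] := eqVneq u 0.
  by rewrite trmx0 mul0mx mxE mulr_ge0 ?norm2_ge0.
have [->|v0] := eqVneq v 0; first by rewrite mulmx0 mxE mulr_ge0 ?norm2_ge0.
have a0 : 0 < norm2 u by rewrite lt_def norm2_eq0 u0 norm2_ge0.
have b0 : 0 < norm2 v by rewrite lt_def norm2_eq0 v0 norm2_ge0.
have uv : (v^T *m u) 0 0 = (u^T *m v) 0 0.
  by rewrite -[in LHS](trmxK u) -trmx_mul mxE.
(* With a = |u|, b = |v| and c = u^T v, the square of |b u - a v| expands to 2ab(ab - c); dividing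
   by ab > 0 gives c <= ab. *)
have := sqr_ge0 (norm2 (norm2 v *: u - norm2 u *: v)).
rewrite sqr_norm2 [_^T]linearB /= ![(_ *: _)^T]linearZ /= mulmxBl !mulmxBr.
rewrite -!(scalemxAl, scalemxAr) !mxE.
move: uv; rewrite !mxE => uv.
have := sqr_norm2 u; have := sqr_norm2 v; rewrite !mxE uv => <- <-.
set a := norm2 u in a0 *; set b := norm2 v in b0 *; set c := \sum_i _ => h.
have : 0 <= (a * b) * (a * b - c) by nra.
by rewrite pmulr_rge0 ?mulr_gt0 // subr_ge0.
Qed.

(** * The spectral norm *)

Lemma norm2_mulmx_bounded (R : realType) (n : nat) (A : 'M[R]_n) :
  exists K, forall v, norm2 (A *m v) <= K * norm2 v.
Proof.
(* The bound is the Frobenius norm: Cauchy-Schwarz is applied to each row of [A]. *)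
pose s := \sum_i norm2 (row i A)^T ^+ 2.
have s0 : 0 <= s by apply: sumr_ge0 => i _; exact: sqr_ge0.
exists (Num.sqrt s) => v.
rewrite -(ler_pXn2r (n := 2)) ?nnegrE ?mulr_ge0 ?sqrtr_ge0 //.
rewrite exprMn (sqr_sqrtr s0) mulr_suml sqr_norm2_sum.
apply: ler_sum => i _; rewrite -exprMn.
have row_dot (w : 'cV[R]_n) : (A *m w) i 0 = ((row i A)^T^T *m w) 0 0.
  by rewrite trmxK -row_mul [RHS]mxE.
rewrite -[leLHS]real_normK ?num_real //.
rewrite ler_pXn2r ?nnegrE ?mulr_ge0 ?norm2_ge0 //.
rewrite ler_norml row_dot dot_le_norm2 andbT lerNl.
(* Cauchy-Schwarz is one-sided here, so the lower bound comes from [- v]. *)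
have := dot_le_norm2 (row i A)^T (- v).
by rewrite mulmxN mxE -(scaleN1r v) norm2Z normrN1 mul1r.
Qed.

Lemma norm2_mulmx_le_opnorm2 (R : realType) (n : nat) (A : 'M[R]_n)
    (v : 'cV[R]_n) :
  norm2 v = 1 -> norm2 (A *m v) <= opnorm2 A.
Proof.
move=> v1; apply: ub_le_sup; last by exists v.
have [K AK] := norm2_mulmx_bounded A.
by exists K => _ [w /= w1 <-]; rewrite (le_trans (AK w)) // w1 mulr1.
Qed.

Lemma opnorm2_le (R : realType) (n : nat) (A : 'M[R]_n) (c : R) : 0 <= c ->
  (forall v, norm2 (A *m v) <= c * norm2 v) -> opnorm2 A <= c.
Proof.
move=> c0 Ac; have [[v v1]|no1] := pselect (exists v : 'cV[R]_n, norm2 v = 1).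
  apply: ge_sup; first by exists (norm2 (A *m v)); exists v.
  by move=> _ [w /= w1 <-]; rewrite (le_trans (Ac w)) // w1 mulr1.
(* Without unit vectors (dimension 0) the supremum is over the empty set, hence 0 by convention. *)
rewrite /opnorm2 (_ : image _ _ = set0) ?sup0 //.
by apply/seteqP; split=> // _ [v /= v1 _]; apply: no1; exists v.
Qed.

Lemma opnorm2_ge0 (R : realType) (n : nat) (A : 'M[R]_n) : 0 <= opnorm2 A.
Proof.
have [[v v1]|no1] := pselect (exists v : 'cV[R]_n, norm2 v = 1).
  exact: le_trans (norm2_ge0 _) (norm2_mulmx_le_opnorm2 _ v1).
rewrite /opnorm2 (_ : image _ _ = set0) ?sup0 //.
by apply/seteqP; split=> // _ [v /= v1 _]; apply: no1; exists v.
Qed.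

Lemma norm2_mulmx_le (R : realType) (n : nat) (A : 'M[R]_n) (v : 'cV[R]_n) :
  norm2 (A *m v) <= opnorm2 A * norm2 v.
Proof.
have [->|v0] := eqVneq v 0.
  by rewrite mulmx0 (eqP (_ : norm2 0 == 0)) ?norm2_eq0 // mulr0.
have nv0 : 0 < norm2 v by rewrite lt_def norm2_eq0 v0 norm2_ge0.
rewrite -ler_pdivrMr // mulrC.
have nZ w : (norm2 v)^-1 * norm2 w = norm2 ((norm2 v)^-1 *: w) :> R.
  by rewrite norm2Z ger0_norm // invr_ge0 norm2_ge0.
by rewrite nZ scalemxAr norm2_mulmx_le_opnorm2 // -nZ mulVf ?gt_eqF.
Qed.

Lemma opnorm2_mulmx_isometry (R : realType) (n : nat) (A P : 'M[R]_n) :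
  P^T *m P = 1%:M -> opnorm2 (A *m P) = opnorm2 A.
Proof.
have le B (Q : 'M[R]_n) : Q^T *m Q = 1%:M -> opnorm2 (B *m Q) <= opnorm2 B.
  move=> QTQ; apply: opnorm2_le => [|v]; first exact: opnorm2_ge0.
  by rewrite -mulmxA -(norm2_isometry (P := Q) v) //; exact: norm2_mulmx_le.
move=> PTP; have PPT := mulmx1C PTP; apply/eqP; rewrite eq_le le //=.
(* The converse inequality is the first one applied to [A *m P] and the isometry [P^T], since A = (A
   P) P^T. *)
by rewrite -{1}[A]mulmx1 -PPT mulmxA le // trmxK.
Qed.

Lemma opnorm2_isometry_mulmx (R : realType) (n : nat) (A P : 'M[R]_n) :
  P^T *m P = 1%:M -> opnorm2 (P *m A) = opnorm2 A.
Proof.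
move=> PTP; rewrite /opnorm2; congr sup.
by apply: eq_imagel => v _; rewrite -mulmxA norm2_isometry.
Qed.

Lemma opnorm2_sqr (R : realType) (n : nat) (Q : 'M[R]_n) :
  Q^T = Q -> opnorm2 (Q *m Q) = opnorm2 Q ^+ 2.
Proof.
move=> QT; have q0 := opnorm2_ge0 Q; have qq0 := opnorm2_ge0 (Q *m Q).
apply/eqP; rewrite eq_le; apply/andP; split.
  apply: opnorm2_le => [|v]; first exact: sqr_ge0.
  rewrite -mulmxA expr2 -mulrA; apply: le_trans (norm2_mulmx_le _ _) _.
  by rewrite ler_wpM2l // norm2_mulmx_le.
(* For symmetric [Q], |Qv|^2 = v^T (QQv) <= |v| |QQv| by Cauchy-Schwarz, so the square root of the
   norm of QQ bounds |Qv| / |v|. *)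
rewrite -[leRHS]sqr_sqrtr // ler_pXn2r ?nnegrE ?sqrtr_ge0 //.
apply: opnorm2_le => [|v]; first exact: sqrtr_ge0.
rewrite -(ler_pXn2r (n := 2)) ?nnegrE ?mulr_ge0 ?norm2_ge0 ?sqrtr_ge0 //.
rewrite exprMn (sqr_sqrtr qq0) sqr_norm2 trmx_mul QT -mulmxA.
apply: le_trans (dot_le_norm2 _ _) _.
by rewrite mulrC expr2 mulrA ler_wpM2r ?norm2_ge0 // mulmxA norm2_mulmx_le.
Qed.

(** * Positive definite matrices: invertibility and positive spectrum *)

Lemma posdefmx_unit (R : realType) (n : nat) (S : 'M[R]_n) :
  posdefmx S -> S \in unitmx.
Proof.
move=> Spos; rewrite -unitmx_tr -row_free_unit -kermx_eq0; apply/rowV0P => u.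
move=> /sub_kermxP uS; apply/eqP; apply/negP => /negP u0.
have := Spos u^T; rewrite trmx_eq0 => /(_ u0).
by rewrite -mulmxA -[S]trmxK -trmx_mul uS trmx0 mulmx0 mxE ltxx.
Qed.

Lemma posdefmx_eigenvalue (R : realType) (n : nat) (S : 'M[R]_n) (a : R) :
  posdefmx S -> eigenvalue S a -> 0 < a.
Proof.
move=> Spos /eigenvalueP[u uS u0]; have := Spos u^T.
rewrite trmx_eq0 => /(_ u0); rewrite trmxK uS -scalemxAl mxE.
rewrite -{1}[u]trmxK -sqr_norm2 pmulr_lgt0 //.
by rewrite exprn_gt0 // lt_def norm2_eq0 trmx_eq0 u0 norm2_ge0.
Qed.

(** * Polynomials in a matrix and existence of the square root *)

Lemma interpolation (F : fieldType) (f : F -> F) (s : seq F) :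
  exists q : {poly F}, {in s, forall a, q.[a] = f a}.
Proof.
elim: s => [|b s [q qf]]; first by exists 0.
(* Nodes may repeat, as eigenvalues do. A new node [b] is handled by Newton's correction: [r]
   vanishes on [s] but not at [b]. *)
have [bs|bs] := boolP (b \in s).
  by exists q => a; rewrite inE => /orP[/eqP->|]; exact: qf.
pose r := \prod_(c <- s) ('X - c%:P).
have rb : r.[b] != 0.
  by rewrite -/(root _ _) root_prod_XsubC.
exists (q + ((f b - q.[b]) / r.[b]) *: r) => a; rewrite inE !hornerE.
move=> /orP[/eqP->|sa]; first by rewrite divfK // addrC subrK.
have /rootP-> : root r a by rewrite root_prod_XsubC.
by rewrite mulr0 addr0 qf.
Qed.

Lemma horner_mx_sym (R : realType) (n : nat) (S : 'M[R]_n.+1) (q : {poly R}) :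
  S^T = S -> (horner_mx S q)^T = horner_mx S q.
Proof.
move=> ST; elim/poly_ind: q => [|q c IH]; first by rewrite rmorph0 trmx0.
rewrite rmorphD rmorphM /= horner_mx_X horner_mx_C linearD /= tr_scalar_mx.
rewrite -mulmxE trmx_mul ST IH; congr (_ + _); symmetry.
by apply: comm_horner_mx.
Qed.

Lemma char_poly_conj (F : fieldType) (n : nat) (P M : 'M[F]_n) :
  P \in unitmx -> char_poly (P *m M *m invmx P) = char_poly M.
Proof.
move=> Pu; pose P' := map_mx polyC P; pose Q' := map_mx polyC (invmx P).
have PQ : P' *m Q' = 1%:M by rewrite -map_mxM mulmxV // map_mx1.
rewrite /char_poly (_ : char_poly_mx _ = P' *m char_poly_mx M *m Q').
  by rewrite !det_mulmx mulrAC -det_mulmx PQ det1 mul1r.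
rewrite /char_poly_mx !map_mxM mulmxBr mulmxBl; congr (_ - _).
by rewrite scalar_mxC -mulmxA PQ mulmx1.
Qed.

(** After diagonalization over [K], [q] acts entrywise on the diagonal; injectivity of [map_mx f]
    brings the identity back to [F]. This lets a complex diagonalization prove an identity between
    real matrices. *)
Lemma horner_mx_fixed (F K : fieldType) (f : {rmorphism F -> K}) (n : nat)
    (S : 'M[F]_n.+1) (U : 'M[K]_n.+1) (D : 'rV[K]_n.+1) (q : {poly F}) :
  U \in unitmx -> map_mx f S = invmx U *m diag_mx D *m U ->
  (forall j, (map_poly f q).[D 0 j] = D 0 j) -> horner_mx S q = S.
Proof.
move=> Uu SE qD; apply: (map_mx_inj (f := f)).
rewrite map_horner_mx SE horner_mx_uconjC // horner_mx_diag.
by congr (_ *m diag_mx _ *m _); apply/rowP => j; rewrite mxE qD.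
Qed.

(* The fourth root, rather than the square root, is extracted so that
   Q = B *m B is visibly positive definite. *)
Lemma posdefmx_fourth_root (R : realType) (n : nat) (S : 'M[R]_n.+1) :
  S^T = S -> posdefmx S ->
  exists2 B : 'M[R]_n.+1, B^T = B & (B *m B) *m (B *m B) = S.
Proof.
move=> ST Spos; have Sherm := complexify_hermsymmx ST.
have /hermitian_normalmx/orthomx_spectralP := Sherm.
have /mxOverP := hermitian_spectral_diag_real Sherm.
have := spectral_unit (complexify S).
set U := spectralmx _; set D := spectral_diag _ => Uu Dreal SE.
pose d j := complex.Re (D 0 j).
have dE j : D 0 j = real_complex R (d j) by rewrite /d RRe_real.
(* Each diagonal entry is a root of the characteristic polynomial of the complexified matrix; being
   real, it is a root of the real one, hence an eigenvalue of [S]. *)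
have d_gt0 j : 0 < d j.
  apply: (posdefmx_eigenvalue (S := S)) => //.
  rewrite eigenvalue_root_char -(fmorph_root (real_complex R)) map_char_poly.
  rewrite -/(complexify S) -[X in root _ X]dE SE -{2}(invmxK U).
  rewrite char_poly_conj ?unitmx_inv //.
  rewrite char_poly_trig ?diag_mx_is_trig // (bigD1 j) //= rootM.
  by rewrite root_XsubC mxE eqxx mulr1n eqxx.
pose f (x : R) := Num.sqrt (Num.sqrt x).
have [q qf] := interpolation f [seq d j | j <- enum 'I_n.+1].
exists (horner_mx S q); first exact: horner_mx_sym.
(* The fourth power of [horner_mx S q] is the value at [S] of the fourth power of [q], which fixes
   every [d j]. *)
rewrite mulmxE -!rmorphM /=; apply: (horner_mx_fixed Uu SE) => j.
rewrite dE horner_map /=; congr (_ %:C)%C.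
rewrite !hornerM qf ?map_f ?mem_enum // /f.
by rewrite -!expr2 sqr_sqrtr ?sqrtr_ge0 // sqr_sqrtr // ltW.
Qed.

Lemma sqrtmxP (R : realType) (n : nat) (S : 'M[R]_n) :
  S \is symmetricmx -> posdefmx S ->
  [/\ sqrtmx S \is symmetricmx, posdefmx (sqrtmx S) & sqrtmx S *m sqrtmx S = S].
Proof.
rewrite symmetricmxE => /eqP ST Spos.
suff [Q QP] : exists Q : 'M[R]_n,
    [/\ Q \is symmetricmx, posdefmx Q & Q *m Q = S].
  by rewrite /sqrtmx; case: xgetP => [_ _ //|/(_ Q)].
(* [horner_mx] requires positive dimension; in dimension 0 all matrices coincide. *)
case: n => [|n] in S ST Spos *.
  exists 0; split; [by rewrite symmetricmxE trmx0 | | by rewrite !thinmx0].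
  by move=> v /negP[]; rewrite [v]flatmx0.
have [B BT BS] := posdefmx_fourth_root ST Spos.
exists (B *m B); split=> //; first by rewrite symmetricmxE trmx_mul BT.
move=> v v0; have Bu : B \in unitmx.
  by move: (posdefmx_unit Spos); rewrite -BS !unitmx_mul => /andP[/andP[]].
(* Symmetry of [B] gives v^T B B v = |Bv|^2, nonzero because [B] is invertible. *)
rewrite mulmxA -mulmxA -[in X in _ *m X *m _]BT -trmx_mul -sqr_norm2.
rewrite exprn_gt0 // lt_def norm2_ge0 andbT norm2_eq0.
by apply: contra v0 => /eqP Bv; rewrite -(mulKmx Bu v) Bv mulmx0.
Qed.

(** * The preconditioned matrix: eigenpairs, diagonalization, conditioning *)

Lemma plt_scalar_identity (F : fieldType) (i a w t tau : F) :
  i * i = -1 -> a != 0 -> a + i != 0 -> t - a * w = tau * (a * t + w) ->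
  w + i * t = a / (a + i) * (1 + i * tau) * (i * (t + a^-1 * w)).
Proof.
move=> ii a0 ai0 e.
(* Absorbing [a] into t + w/a makes the factor a t + w appear next to [tau], so that [e] eliminates
   [tau]. *)
have -> : a / (a + i) * (1 + i * tau) * (i * (t + a^-1 * w)) =
    i / (a + i) * (a * t + w + i * (tau * (a * t + w))).
  by field; rewrite ai0 a0.
rewrite -e; apply: (mulfI ai0); rewrite mulrA mulrCA divff // mulr1.
rewrite !(mulrDr i) !mulrDl !mulrDr !mulrA ii; ring: ii.
Qed.

Theorem theorem4p2 (R : realType) (n : nat) (W T : 'M[R]_n) (alpha : R)
    (tau : 'I_n -> R) (p : 'I_n -> 'cV[R]_n) :
  let A : 'M[R[i]]_n := complexify W + 'i%C *: complexify T in
  let S : 'M[R]_n := alpha *: T + W in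
  let PLT : 'M[R[i]]_n := 'i%C *: complexify (T + alpha^-1 *: W) in
  let Z : 'M[R]_n :=
    invmx (sqrtmx S) *m (T - alpha *: W) *m invmx (sqrtmx S) in
  let alphaC : R[i] := real_complex R alpha in
  let eta : 'I_n -> R[i] := fun j =>
    alphaC / (alphaC + 'i%C) * (1 + 'i%C * real_complex R (tau j)) in
  let x : 'I_n -> 'cV[R]_n := fun j => invmx (sqrtmx S) *m p j in
  let X : 'M[R]_n := \matrix_(k, j) x j k 0 in
  let Lambda : 'M[R[i]]_n := diag_mx (\row_j eta j) in
  W \is symmetricmx -> posdefmx W ->
  T \is symmetricmx -> indefinitemx T ->
  0 < alpha -> posdefmx S ->
  eigenvalues_are Z tau ->
  orthonormal_family p ->
  (forall j, eigenvector Z (tau j) (p j)) ->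
  [/\ PLT \in unitmx /\ Z \is symmetricmx,
      eigenvalues_are (invmx PLT *m A) eta,
      forall j, eigenvector (invmx PLT *m A) (eta j) (complexify (x j)),
      X \in unitmx /\
      invmx PLT *m A =
        complexify X *m Lambda *m invmx (complexify X)
    & cond2 X = Num.sqrt (cond2 S)].
Proof.
move=> A S PLT Z alphaC eta x X Lambda Wsym _ Tsym _ a0 Spos _ portho peig.
have Ssym : S \is symmetricmx.
  move: Wsym Tsym; rewrite !symmetricmxE => /eqP WT /eqP TT.
  by rewrite /S linearD linearZ /= WT TT.
(* From here on [Q] is any symmetric positive definite matrix with square [S]. *)
have := sqrtmxP Ssym Spos; set Q := sqrtmx S in Z x X peig *; clearbody Q.
move=> [Qsym Qpos QQ].
have Qu := posdefmx_unit Qpos; have Su := posdefmx_unit Spos.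
move: Qsym; rewrite symmetricmxE => /eqP QT.
have PLTE : PLT = ('i%C / alphaC) *: complexify S.
  rewrite /PLT /S; apply/matrixP => k l; rewrite !mxE /= -mulrA; congr (_ * _).
  rewrite -/alphaC -fmorphV -rmorphM; congr (real_complex R _).
  by field; rewrite gt_eqF.
have i0 : 'i%C != 0 :> R[i] by rewrite eq_complex /= oner_eq0 andbF.
have aC0 : alphaC != 0 by rewrite fmorph_eq0 gt_eqF.
have ai0 : alphaC + 'i%C != 0 by rewrite eq_complex /= add0r oner_eq0 andbF.
have PLTu : PLT \in unitmx.
  by rewrite PLTE unitmxZ ?unitfE ?mulf_neq0 ?invr_eq0 // map_unitmx.
pose P : 'M[R]_n := \matrix_(k, j) p j k 0.
have PTP : P^T *m P = 1%:M.
  apply/matrixP => j k; rewrite !mxE -(portho j k) mxE.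
  by apply: eq_bigr => l _; rewrite !mxE.
have Pu : P \in unitmx by case/mulmx1_unit: PTP.
have XE : X = invmx Q *m P.
  by apply/matrixP => k j; rewrite !mxE; apply: eq_bigr => l _; rewrite mxE.
have Xu : X \in unitmx by rewrite XE unitmx_mul unitmx_inv Qu.
have Zx j : (T - alpha *: W) *m x j = tau j *: (S *m x j).
  have [_ Zp] := peig j.
  (* Since S x_j = Q p_j, this is Z p_j = tau_j p_j multiplied by [Q] on the left. *)
  rewrite -QQ -mulmxA mulKVmx // scalemxAr -Zp /Z -!mulmxA mulKVmx //.
have Ax j : A *m complexify (x j) = eta j *: (PLT *m complexify (x j)).
  rewrite /A /PLT mulmxDl -!scalemxAl /complexify map_mxD mulmxDl map_mxZ.
  rewrite -scalemxAl -!map_mxM; apply/matrixP => k l.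
  (* The claim is checked coordinatewise: [w] and [t] stand for W x_j and T x_j, whose entries
     satisfy the hypothesis of [plt_scalar_identity]. *)
  have := congr1 (fun M : 'cV[R]_n => real_complex R (M k l)) (Zx j).
  rewrite /S mulmxBl mulmxDl -!scalemxAl; move: (W *m x j) (T *m x j) => w t.
  rewrite !mxE rmorphB !(rmorphM, rmorphD) /= fmorphV => e.
  by apply: plt_scalar_identity => //; rewrite -expr2 sqr_i.
have eigM j : eigenvector (invmx PLT *m A) (eta j) (complexify (x j)).
  split; last by rewrite -mulmxA Ax -scalemxAr mulKmx.
  have [p0 _] := peig j; rewrite map_mx_eq0; apply: contra p0 => /eqP xj0.
  (* p_j = Q x_j, so x_j = 0 would force p_j = 0. *)
  by rewrite -(mulKVmx Qu (p j)) [invmx _ *m _]xj0 mulmx0.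
have cXu : complexify X \in unitmx by rewrite map_unitmx.
have diagM : invmx PLT *m A = complexify X *m Lambda *m invmx (complexify X).
  apply: (canRL (mulmxK cXu)); apply/matrixP => k j.
  have [_ /matrixP/(_ k 0)] := eigM j.
  rewrite mul_mx_diag !mxE mulrC => <-.
  by apply: eq_bigr => l _; congr (_ * _); rewrite !mxE.
split=> //.
- split=> //; rewrite symmetricmxE /Z !trmx_mul trmx_inv QT -mulmxA.
  move: Wsym Tsym; rewrite !symmetricmxE => /eqP WT /eqP TT.
  by rewrite linearB linearZ /= WT TT.
(* Multiplicities are read off the diagonalization: similarity preserves the characteristic
   polynomial. *)
- rewrite /eigenvalues_are diagM char_poly_conj //.
  rewrite char_poly_trig ?diag_mx_is_trig //.
  by apply: eq_bigr => j _; rewrite !mxE eqxx.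
- have PPT := mulmx1C PTP.
  have XV : invmx X = P^T *m Q.
    have XX' : X *m (P^T *m Q) = 1%:M.
      by rewrite XE -mulmxA (mulmxA P) PPT mul1mx mulVmx.
    by rewrite -[LHS]mulmx1 -XX' mulKmx.
  have VT : (invmx Q)^T = invmx Q by rewrite trmx_inv QT.
  have SV : invmx S = invmx Q *m invmx Q.
    have SVV : S *m (invmx Q *m invmx Q) = 1%:M.
      by rewrite -QQ -mulmxA mulKVmx // mulmxV.
    by rewrite -[LHS]mulmx1 -SVV mulKmx.
  rewrite /cond2 XV SV -QQ !opnorm2_sqr // XE.
  rewrite (opnorm2_mulmx_isometry _ PTP).
  rewrite (@opnorm2_isometry_mulmx _ _ _ P^T) ?trmxK //.
  (* Both sides are now the product of the norms of [Q] and its inverse, the right one as the root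
     of a square. *)
  by rewrite -exprMn sqrtr_sqr ger0_norm ?mulr_ge0 ?opnorm2_ge0 // mulrC.
Qed.
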